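(* Let $p$ be an odd prime and $k\in\mathbb{N}$ with $2\le k\le\frac{p-1}{2}$ such that $p\equiv 1\pmod{2k}$. Let $\alpha_1,\ldots,\alpha_{(p-1)/k}$ be the distinct $k$-th power residues modulo $p$ and let $T\left(\frac{p-1}{k}\right)=\prod_{1\le i<j\le\frac{p-1}{k}}(\alpha_i-\alpha_j)$. (a) If $p\equiv 1\pmod{4k}$, then $$\left(\frac{\sqrt{S_{3+\frac{p-1}{k},k}(-1,p)}}{p}\right)=\left(\frac{k(3k-1)(4k-1)\left(6k^3+(3k-1)(2k-1)(k-1)\right)}{p}\right)\left(\frac{\left(\frac{p-1}{k}-1\right)!!}{p}\right)\left(\frac{T\left(\frac{p-1}{k}\right)}{p}\right).$$ (b) If $k$ is even and $p\equiv 2k+1\pmod{4k}$, then $\left(\frac{\sqrt{S_{3+\frac{p-1}{k},k}(-1,p)}}{p}\right)$ equals $\left(\frac{T\left(\frac{p-1}{k}\right)}{p}\right)$ if $p=2k+1$, and otherwise equals $$\left(\frac{(k-1)(2k-1)(4k-1)\left(6k^3+(3k-1)(2k-1)(k-1)\right)}{p}\right)\left(\frac{\left(\frac{p-1}{k}\right)!!}{p}\right)\left(\frac{T\left(\frac{p-1}{k}\right)}{p}\right).$$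
   Context: For an odd prime $p$ and an integer $k\ge 2$ with $k\mid p-1$, the $\alpha_i$ $(1\le i\le\frac{p-1}{k})$ are integers representing the distinct (nonzero) $k$-th power residues modulo $p$, and for $n\in\mathbb{N}$, $d\in\mathbb{Z}$, $$S_{n,k}(d,p)=\det\left[(\alpha_i+d\,\alpha_j)^n\right]_{1\le i,j\le \frac{p-1}{k}}.$$ When $p\equiv 1\pmod{2k}$ and $n$ is odd, $S_{n,k}(-1,p)$ is the determinant of a skew-symmetric integer matrix of even order, hence the square of an integer, and $\sqrt{S_{n,k}(-1,p)}$ denotes its integer square root (the sign is immaterial inside the Legendre symbol when $p\equiv 1\pmod 4$, which is so in all the cases considered). $\left(\frac{\cdot}{p}\right)$ is the Legendre symbol. For $a\in\mathbb{N}$, $a!!$ is the double factorial: $a!!=a\cdot(a-2)!!$ if $a>2$ and $a!!=a$ if $a\in\{1,2\}$. *)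

(* Defs.v *)
From mathcomp Require Import all_boot all_order all_algebra.
From Stdlib Require Import PeanoNat.

Set Implicit Arguments.
Unset Strict Implicit.
Unset Printing Implicit Defensive.

Import Order.TTheory GRing.Theory Num.Theory.
Local Open Scope ring_scope.

Definition legendre (a : int) (p : nat) : int :=
  if (p %| a)%Z then 0
  else if [exists x : 'I_p, (a == x%:Z ^+ 2 %[mod p])%Z] then 1 else -1.

Definition kth_power_residue (p k : nat) (a : int) : Prop :=
  ~~ (p %| a)%Z /\ exists x : int, (a = x ^+ k %[mod p])%Z.

(* The integers [alpha i] are arbitrary representatives, in an arbitrary order,
   of the classes mod [p] of the nonzero [k]-th powers. *)
Definition kth_residue_system (p k m : nat) (alpha : 'I_m -> int) : Prop :=
  [/\ forall i, kth_power_residue p k (alpha i),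
      forall i j, (alpha i = alpha j %[mod p])%Z -> i = j
    & forall a, kth_power_residue p k a ->
        exists i, (alpha i = a %[mod p])%Z].

Definition Sdet (m : nat) (alpha : 'I_m -> int) (n : nat) (d : int) : int :=
  \det (\matrix_(i, j) (alpha i + d * alpha j) ^+ n).

Definition Tprod (m : nat) (alpha : 'I_m -> int) : int :=
  \prod_(i < m) \prod_(j < m | (i < j)%N) (alpha i - alpha j).

(* The nonnegative square root when [x] is a perfect square; on other integers
   the value (the floor of the square root of the absolute value) is junk. *)
Definition isqrtz (x : int) : int := (Nat.sqrt `|x|%N)%:Z.

Fixpoint double_fact (a : nat) : nat :=
  if a is b.+2 then (a * double_fact b)%N else 1%N.

(* Main.v *)
(* Put m = (p - 1) / k and N = m + 3, and read everything in F_p, where the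
   alpha_i are m-th roots of unity.  Reducing exponents mod m,
     (x - y)^N = sum_{r < m} (-1)^(r+1) e_r x^r y^(-r) y^3,
     e_r = C(N, r) + C(N, m + r),
   so the matrix is a product of a Vandermonde matrix in the alpha_i, a diagonal
   matrix, a Vandermonde matrix in the 1/alpha_i and a diagonal matrix.  Hence
   S = (T w^2)^2 prod_r e_r with w = prod_i alpha_i.  The symmetries e_0 = e_3,
   e_1 = e_2, e_r = e_(N-r) make prod_r e_r the square of
   q = e_0 e_1 prod_{4 <= r < m/2 + 2} C(N, r), so sqrt S = +- T q w^2, and the
   sign is harmless as p = 1 mod 4.  Up to squares, q is computed from
   C(N, r) = N! / (r! (N - r)!), from (2j)! (2j+1)! ~ 2j+1, and from k m = -1.
   Over the integers, S is a square since an even-order skew-symmetric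
   determinant over Q is one (by Schur complements). *)
Require Import Defs.
From mathcomp Require Import all_boot all_order all_fingroup all_algebra.
From mathcomp Require Import cyclic finfield ring zify.
From Stdlib Require PeanoNat.

Set Implicit Arguments.
Unset Strict Implicit.
Unset Printing Implicit Defensive.

Import Order.TTheory GRing.Theory Num.Theory.
Local Open Scope ring_scope.


(** * Skew-symmetric determinants as squares *)

(** Induction on the order, two at a time: a transposition brings a nonzero entry to position (0,
    1), and the Schur complement of the leading 2 by 2 block is again skew-symmetric. *)
Lemma det_skew_sqr (R : numFieldType) (n : nat) (A : 'M[R]_n) :
  ~~ odd n -> A^T = - A -> exists x, \det A = x ^+ 2.
Proof.
have [N] := ubnP n; elim: N n A => // N IHN [|[|n]] //= A lenN.
  by move=> _ _; exists 1; rewrite det_mx00 expr1n.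
rewrite negbK => evn skA.
have skE i j : A j i = - A i j by move/matrixP/(_ i j): skA; rewrite !mxE.
have diag0 i : A i i = 0.
  by have /eqP := skE i i; rewrite -addr_eq0 -mulr2n mulrn_eq0 => /eqP ->.
have [j /= nzj|row0] := pickP [pred j | A 0 j != 0]; last first.
  exists 0; rewrite expr0n (expand_det_row _ 0) big1 // => j _.
  by have /negbFE/eqP-> := row0 j; rewrite mul0r.
have nz_j : j != 0 by apply: contraNneq nzj => ->; rewrite diag0.
(* Permuting rows and columns by the same transposition preserves skew symmetry and the determinant;
   [t] fixes 0, so [B 0 1] is [A 0 j]. *)
pose t := tperm 1 j; pose B := row_perm t (col_perm t A).
have detB : \det B = \det A.
  rewrite /B row_permE col_permE !det_mulmx !det_perm odd_permV mulrCA mulrA.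
  by rewrite -mulrA -expr2 sqrr_sign mulr1.
have skB : B^T = - B by apply/matrixP=> a b; rewrite !mxE skE.
have B01 : B 0 1 != 0.
  rewrite !mxE tpermL; suff -> : t 0 = 0 by [].
  by rewrite tpermD.
rewrite -detB; move: B skB B01 {detB} => B skB B01.
have {}skE i k : B k i = - B i k by move/matrixP/(_ i k): skB; rewrite !mxE.
have {}diag0 i : B i i = 0.
  by have /eqP := skE i i; rewrite -addr_eq0 -mulr2n mulrn_eq0 => /eqP ->.
pose B' : 'M_(2 + n) := B.
pose U := ulsubmx B'; pose C := ursubmx B'; pose D := drsubmx B'.
have eB : B' = block_mx U C (- C^T) D.
  rewrite -[LHS]submxK; congr block_mx.
  by apply/matrixP=> a b; rewrite !mxE skE.
have skU : U^T = - U by apply/matrixP=> a b; rewrite !mxE skE.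
have skD : D^T = - D by apply/matrixP=> a b; rewrite !mxE skE.
have detU : \det U = (B 0 1) ^+ 2.
  rewrite (expand_det_row _ 0) !big_ord_recl big_ord0 /cofactor !det_mx11 !mxE /=.
  have lE (a b : 'I_2) (c d : 'I_n.+2) : val a = val c -> val b = val d ->
      B' (lshift n a) (lshift n b) = B c d.
    by move=> ac bd; congr (B _ _); apply: val_inj.
  rewrite (lE _ _ 0 0) // (lE _ _ 1 1) // (lE _ _ 0 1) // (lE _ _ 1 0) //.
  by rewrite diag0 (skE 0 1); ring.
have unU : U \in unitmx by rewrite unitmxE detU unitfE expf_neq0.
have invN : invmx (- U) = - invmx U.
  rewrite -[LHS]mul1mx -(mulVmx unU) -mulmxA -[U *m _]opprK -mulNmx mulmxV.
    by rewrite mulmxN mulmx1.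
  by rewrite -skU unitmx_tr.
(* Left multiplication by [L] clears the lower-left block [- C^T] and leaves the Schur complement
   [D']. *)
pose L := block_mx 1%:M 0 (C^T *m invmx U) 1%:M.
pose D' := D + C^T *m invmx U *m C.
have eL : L *m B' = block_mx U C 0 D'.
  rewrite eB mulmx_block !mul1mx !mul0mx !addr0 mulmxKV // subrr.
  by rewrite addrC.
have dB : \det B = \det U * \det D'.
  rewrite -(det_ublock _ C) -eL det_mulmx det_lblock !det1 !mul1r.
  by [].
have skD' : D'^T = - D'.
  rewrite linearD /= !trmx_mul trmxK trmx_inv skU skD opprD; congr (_ + _).
  by rewrite invN mulNmx mulmxN mulmxA.
have [|//|x ex] := IHN _ D' _ _ skD'; first exact: ltnW.
by exists (B 0 1 * x); rewrite dB detU ex exprMn.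
Qed.

Lemma isqrtz_sqr (y : int) : isqrtz (y ^+ 2) = `|y|.
Proof.
by rewrite /isqrtz abszX expnS expn1 PeanoNat.Nat.sqrt_square -abszE.
Qed.

(** In lowest terms [a * denq x ^+ 2 = numq x ^+ 2], so the denominator divides the numerator and
    the quotient is the integer root. *)
Lemma rat_sqrt_int (a : int) (x : rat) :
  a%:~R = x ^+ 2 -> exists y : int, a = y ^+ 2.
Proof.
move=> ax; have nzd : (denq x)%:~R != 0 :> rat by rewrite intr_eq0 denq_neq0.
have e : a * denq x ^+ 2 = numq x ^+ 2.
  apply: (@intr_inj rat); rewrite rmorphM !rmorphXn /= ax -{1}(divq_num_den x).
  by rewrite expr_div_n divfK ?expf_neq0.
have : (denq x %| numq x)%Z.
  rewrite -[(_ %| _)%Z](@dvdn_pexp2r _ _ 2) // -!abszX -e.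
  exact: (dvdz_mull a (dvdzz _)).
case/dvdzP=> y ey; exists y; apply: (@mulIf _ (denq x ^+ 2)).
  by rewrite expf_neq0 ?denq_neq0.
by rewrite e ey exprMn.
Qed.

Lemma isqrtz_det_skew (n : nat) (A : 'M[int]_n) :
  ~~ odd n -> A^T = - A -> isqrtz (\det A) ^+ 2 = \det A.
Proof.
move=> evn skA; pose B : 'M[rat]_n := map_mx intr A.
have skB : B^T = - B.
  apply/matrixP => i j; move/matrixP/(_ i j): skA; rewrite !mxE => ->.
  by rewrite rmorphN.
have [x] := @det_skew_sqr _ _ B evn skB; rewrite det_map_mx => /rat_sqrt_int[y ->].
by rewrite isqrtz_sqr real_normK ?num_real.
Qed.

(** * The quadratic character of a finite field *)

Section QuadraticCharacter.
Variable F : finFieldType.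

Definition qchar (x : F) : int :=
  if x == 0 then 0 else if [exists y, x == y ^+ 2] then 1 else -1.

Lemma qchar_sqr (x : F) : x != 0 -> qchar (x ^+ 2) = 1.
Proof.
move=> nzx; rewrite /qchar expf_eq0 (negPf nzx) /=.
by case: existsP => // -[]; exists x.
Qed.

Lemma finField_generator :
  exists2 g : F, forall x, x != 0 -> exists i, x = g ^+ i
    & forall i, (g ^+ i == 1) = (#|F|.-1 %| i)%N.
Proof.
have /cyclicP[g gE] := field_unit_group_cyclic [set: {unit F}].
exists (val g) => [x|i]; last first.
  by rewrite -card_finField_unit gE -[#|_|]/#[g]%g order_dvdn -FinRing.val_unitX.
rewrite -unitfE => Ux.
have /cycleP[i e] : Sub x Ux \in <[g]>%g by rewrite -gE inE.
by exists i; rewrite -FinRing.val_unitX -e.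
Qed.

Lemma qcharM : {morph qchar : x y / x * y}.
Proof.
move=> x y; have [->|nzx] := eqVneq x 0; first by rewrite mul0r /qchar eqxx mul0r.
have [->|nzy] := eqVneq y 0; first by rewrite mulr0 /qchar eqxx mulr0.
rewrite /qchar mulf_eq0 (negPf nzx) (negPf nzy) /=.
have [g gP gO] := finField_generator.
(* A nonsquare is an odd power of the generator [g], so a product of two nonsquares is an even
   power; this settles the last of the four cases below. *)
have nsq z : z != 0 -> ~ (exists y, z == y ^+ 2) -> exists i, z = g ^+ i.*2.+1.
  move=> /gP[i ->] nsq; exists i./2.
  case: (boolP (odd i)) => oi; first by rewrite -[in LHS](odd_double_half i) oi.
  case: nsq; exists (g ^+ i./2).
  by rewrite -exprM muln2 -[in X in X == _](odd_double_half i) (negPf oi).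
case: existsP => sxy; case: existsP => sx; case: existsP => sy //.
- case: sy; case: sxy => z /eqP ez; case: sx => u /eqP eu.
  have nzu : u != 0 by apply: contraNneq nzx => u0; rewrite eu u0 expr0n.
  exists (z / u); rewrite expr_div_n -ez -eu; apply/eqP; by field.
- case: sx; case: sxy => z /eqP ez; case: sy => u /eqP eu.
  have nzu : u != 0 by apply: contraNneq nzy => u0; rewrite eu u0 expr0n.
  exists (z / u); rewrite expr_div_n -ez -eu; apply/eqP; by field.
- case: sxy; case: sx => z /eqP->; case: sy => u /eqP->.
  by exists (z * u); rewrite exprMn.
- case: sxy; have [i ->] := nsq x nzx sx; have [j ->] := nsq y nzy sy.
  exists (g ^+ (i + j).+1); rewrite -exprM -exprD; apply/eqP; congr (_ ^+ _).
  lia.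
Qed.

Lemma qchar_mul_sqr (x y : F) : y != 0 -> qchar (x * y ^+ 2) = qchar x.
Proof. by move=> nzy; rewrite qcharM qchar_sqr ?mulr1. Qed.

(** Makes precise the phrase [up to squares]: later uses exhibit the square factors explicitly
    through [u] and [v]. *)
Lemma qchar_eq_mod_sqr {x y : F} (u v : F) :
  u != 0 -> v != 0 -> x * u ^+ 2 = y * v ^+ 2 -> qchar x = qchar y.
Proof.
by move=> nzu nzv e; rewrite -(qchar_mul_sqr x nzu) e qchar_mul_sqr.
Qed.

Lemma qcharN (x : F) : (#|F| = 1 %[mod 4])%N -> qchar (- x) = qchar x.
Proof.
move=> F1; have [c c_gt0 ec] : exists2 c, (0 < c)%N & #|F|.-1 = (4 * c)%N.
  have : (1 < #|F|)%N := card_finNzRing_gt1 F.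
  by exists (#|F|.-1 %/ 4)%N; lia.
have [g gP gO] := finField_generator.
rewrite -mulN1r; suff [y nzy ->] : exists2 y : F, y != 0 & -1 = y ^+ 2.
  by rewrite mulrC qchar_mul_sqr.
have nzg : g ^+ c != 0.
  apply: expf_neq0; apply/eqP => g0; have := gO #|F|.-1; rewrite dvdnn g0 expr0n.
  have -> : (#|F|.-1 == 0)%N = false by lia.
  by rewrite eq_sym oner_eq0.
(* Here c = (#|F| - 1) / 4. The square of g^(2c) is 1, while g^(2c) itself is not, as 4c does not
   divide 2c; hence g^(2c) = -1. *)
exists (g ^+ c) => //; apply/eqP; rewrite -exprM eq_sym.
have: (g ^+ (c * 2)) ^+ 2 == 1 ^+ 2.
  by rewrite expr1n -exprM gO ec; apply/dvdnP; exists 1; lia.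
rewrite eqf_sqr gO ec => /orP[/dvdnP[[|d] ed]|//]; nia.
Qed.
End QuadraticCharacter.


(** * Folding the binomial expansion and factoring the determinant *)

(* Up to sign, the coefficient e_r of x^r y^(3-r) in (x - y)^(m+3) reduced by
   x^m = y^m = 1. *)
Definition fold_bin (m r : nat) : nat := ('C(m + 3, r) + 'C(m + 3, m + r))%N.

(** This is q: one factor from each pair of equal coefficients. The range 4 <= r < m is paired off
    by r -> m + 3 - r, and m/2 + 2 starts its upper half. *)
Definition half_prod (m : nat) : nat :=
  (fold_bin m 0 * fold_bin m 1 * \prod_(4 <= r < m./2.+2) 'C(m + 3, r))%N.

Lemma expr_diff_fold (F : fieldType) (m : nat) (x y : F) :
  ~~ odd m -> (3 < m)%N -> x ^+ m = 1 -> y ^+ m = 1 ->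
  (x - y) ^+ (m + 3) =
    \sum_(r < m) x ^+ r * ((-1) ^+ r.+1 * (fold_bin m r)%:R) * y^-1 ^+ r * y ^+ 3.
Proof.
move=> evm m_gt3 xm ym; have nzy : y != 0.
  apply: contraTneq isT => y0; move/eqP: ym; rewrite y0 expr0n.
  by case: m m_gt3 {evm xm} => //= m _; rewrite eq_sym oner_eq0.
(* The binomial index [n] and the exponent [i] are kept apart, so that only the exponent is reduced
   mod m. *)
pose f n i := (-1) ^+ i.+1 * 'C(m + 3, n)%:R * (x / y) ^+ i * y ^+ 3.
have -> : (x - y) ^+ (m + 3) = \sum_(0 <= i < m + 4) f i i.
  rewrite -opprB exprNn -signr_odd oddD (negPf evm) expr1 exprBn big_mkord mulN1r.
  rewrite -sumrN (addnS m 3); apply: eq_bigr => -[i /= le_i] _; rewrite /f expr_div_n.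
  have -> : y ^+ (m + 3 - i) = y ^+ 3 / y ^+ i.
    apply: (mulIf (expf_neq0 i nzy)); rewrite -exprD divfK ?expf_neq0 // subnK //.
    by rewrite exprD ym mul1r.
  by rewrite -mulr_natr (exprS (-1) i); field; rewrite expf_neq0.
rewrite (@big_cat_nat _ _ _ m) ?leq_addr //=.
have -> : \sum_(m <= i < m + 4) f i i = \sum_(0 <= i < 4) f (i + m)%N (i + m)%N.
  by rewrite -{1}[m]add0n big_addn (addnC m 4) addnK.
have -> : \sum_(0 <= i < 4) f (i + m)%N (i + m)%N = \sum_(0 <= i < m) f (i + m)%N i.
  (* The range can grow from 4 to m because C(m + 3, i + m) = 0 for i > 3. *)
  rewrite [RHS](@big_cat_nat _ _ _ 4) //= [X in _ + X]big_nat_cond [X in _ + X]big1 ?addr0.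
    apply: eq_bigr => i _; rewrite /f -addSn !exprD !expr_div_n xm ym.
    by rewrite -(signr_odd _ m) (negPf evm) divr1 !mulr1.
  move=> i /andP[/andP[i4 _] _]; rewrite /f bin_small ?mulr0 ?mul0r //; lia.
rewrite -big_split /= big_mkord; apply: eq_bigr => i _.
by rewrite /f /fold_bin natrD expr_div_n exprVn (addnC m i); ring.
Qed.

(** Each index lies in m - 1 pairs, counting those where it is the smaller and those where it is the
    larger element. *)
Lemma prod_lt_mul (F : comPzRingType) (m : nat) (a : 'I_m -> F) :
  \prod_(i < m) \prod_(j < m | (i < j)%N) (a i * a j) = (\prod_i a i) ^+ m.-1.
Proof.
rewrite -prodrXl.
rewrite (eq_bigr (fun i : 'I_m => (\prod_(j < m | (i < j)%N) a i) *
  \prod_(j < m | (i < j)%N) a j)); last by move=> i _; rewrite -big_split.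
rewrite big_split /= [X in _ * X](exchange_big_dep xpredT) //= -big_split /=.
apply: eq_bigr => i _; rewrite !prodr_const -exprD; congr (_ ^+ _).
have : #|predC1 i| = m.-1 by rewrite cardC1 card_ord.
rewrite -(cardID (fun j : 'I_m => (i < j)%N) (predC1 i)) => <-.
congr addn; apply: eq_card => j; rewrite !inE -(inj_eq val_inj) /= unfold_in /=; lia.
Qed.

Lemma prod_lt_opp (F : comPzRingType) (m : nat) (a : 'I_m -> 'I_m -> F) :
  \prod_(i < m) \prod_(j < m | (i < j)%N) (- a i j) =
  (-1) ^+ 'C(m, 2) * \prod_(i < m) \prod_(j < m | (i < j)%N) a i j.
Proof.
transitivity (\prod_(i < m) \prod_(j < m | (i < j)%N) (-1 * a i j)).
  by apply: eq_bigr => i _; apply: eq_bigr => j _; rewrite mulN1r.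
rewrite (eq_bigr (fun i : 'I_m => (\prod_(j < m | (i < j)%N) -1) *
  \prod_(j < m | (i < j)%N) a i j)); last by move=> i _; rewrite -big_split.
rewrite big_split /=; congr (_ * _).
rewrite (exchange_big_dep xpredT) //= -bin2_sum big_mkord -prodrXr.
apply: eq_bigr => i _; rewrite -(big_ord_widen _ (fun=> -1)) 1?ltnW //.
by rewrite prodr_const card_ord.
Qed.

Lemma det_power_diff (F : fieldType) (m : nat) (a : 'I_m -> F) :
  ~~ odd m -> (3 < m)%N -> (forall i, a i ^+ m = 1) ->
  \det (\matrix_(i, j) (a i - a j) ^+ (m + 3)) =
  (\prod_(i < m) \prod_(j < m | (i < j)%N) (a i - a j)) ^+ 2 *
    (\prod_i a i) ^+ 4 * (\prod_(r < m) fold_bin m r)%:R.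
Proof.
move=> evm m_gt3 am.
have nza i : a i != 0.
  apply: contraTneq isT => y0; move/eqP: (am i); rewrite y0 expr0n.
  by case: m m_gt3 {evm a am i y0} => //= m _; rewrite eq_sym oner_eq0.
pose d : 'rV[F]_m := \row_r ((-1) ^+ r.+1 * (fold_bin m r)%:R).
pose u : 'rV[F]_m := \row_i a i; pose v : 'rV[F]_m := \row_i (a i)^-1.
pose w : 'rV[F]_m := \row_i (a i) ^+ 3.
have -> : \matrix_(i, j) (a i - a j) ^+ (m + 3) =
    (Vandermonde m u)^T *m diag_mx d *m Vandermonde m v *m diag_mx w.
  apply/matrixP => i j; rewrite mxE expr_diff_fold // mul_mx_diag mxE.
  rewrite mul_mx_diag mxE mxE mulr_suml; apply: eq_bigr => r _.
  by rewrite !mxE.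
rewrite !det_mulmx !det_diag det_tr !det_Vandermonde.
set T := \prod_(i < m) \prod_(j < m | (i < j)%N) (a i - a j).
set P := \prod_i a i.
have eU : \prod_(i < m) \prod_(j < m | (i < j)%N) (u 0 j - u 0 i) = (-1) ^+ 'C(m, 2) * T.
  rewrite -prod_lt_opp; apply: eq_bigr => i _; apply: eq_bigr => j _.
  by rewrite !mxE opprB.
(* 1/a_j - 1/a_i = (a_i - a_j) / (a_i a_j), and the denominators multiply to [P ^+ m.-1] by
   [prod_lt_mul]. *)
have eV : \prod_(i < m) \prod_(j < m | (i < j)%N) (v 0 j - v 0 i) * P ^+ m.-1 = T.
  rewrite -prod_lt_mul -big_split /=; apply: eq_bigr => i _.
  rewrite -big_split /=; apply: eq_bigr => j _; rewrite !mxE.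
  by field; rewrite !nza.
have ew : \prod_i w 0 i = P ^+ 3.
  by rewrite -prodrXl; apply: eq_bigr => i _; rewrite mxE.
have ed : \prod_i d 0 i = (-1) ^+ 'C(m.+1, 2) * (\prod_(r < m) fold_bin m r)%:R.
  rewrite natr_prod (eq_bigr _ (fun i _ => mxE _ _ _ _)) big_split /=; congr (_ * _).
  rewrite prodrXr -bin2_sum big_mkord big_ord_recl /=; congr (_ ^+ _).
(* As P^m = 1, dividing by P^(m-1) multiplies by P; with the P^3 coming from [w] this gives the
   exponent 4. *)
have Pm : P ^+ m = 1 by rewrite -prodrXl big1.
have Pm1 : P ^+ m.-1 * P = 1 by rewrite -exprSr prednK // ltnW // ltnW // ltnW.
have nzP : P != 0 by apply/prodf_neq0.
(* The exponents add up to m + 2 C(m, 2), which is even. *)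
have sgn : (-1) ^+ 'C(m, 2) * (-1) ^+ 'C(m.+1, 2) = 1 :> F.
  rewrite -exprD binS bin1 addnA addnn -signr_odd oddD odd_double.
  by rewrite (negPf evm).
rewrite eU ew ed; apply: (mulIf (expf_neq0 m.-1 nzP)).
transitivity (((-1) ^+ 'C(m, 2) * (-1) ^+ 'C(m.+1, 2)) * T *
  (\prod_(i < m) \prod_(j < m | (i < j)%N) (v 0 j - v 0 i) * P ^+ m.-1) *
  (\prod_(r < m) fold_bin m r)%:R * P ^+ 3); first by ring.
rewrite sgn eV; transitivity (T ^+ 2 * P ^+ 3 * (\prod_(r < m) fold_bin m r)%:R *
  (P ^+ m.-1 * P)); first by rewrite Pm1; ring.
by ring.
Qed.


(** * The product of the coefficients and factorial identities *)

Lemma prod_upper_half_reflect (h : nat) (f : nat -> nat) : (1 < h)%N ->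
  (\prod_(h.+2 <= r < h.*2) f r = \prod_(4 <= r < h.+2) f (h.*2 + 3 - r))%N.
Proof.
move=> h_gt1; rewrite big_nat_rev /=.
have {1}-> : (h.+2 = 4 + (h - 2))%N by lia.
rewrite big_addn; have -> : (h.*2 - (h - 2) = h.+2)%N by lia.
by rewrite !big_nat; apply: eq_bigr => r /andP[r1 r2]; congr f; lia.
Qed.

Lemma prod_fold_bin (h : nat) : (1 < h)%N ->
  (\prod_(r < h.*2) fold_bin h.*2 r = half_prod h.*2 ^ 2)%N.
Proof.
move=> h_gt1; set m := h.*2.
have fE r : (3 < r)%N -> fold_bin m r = 'C(m + 3, r).
  by move=> r3; rewrite /fold_bin [X in (_ + X)%N]bin_small ?addn0 //; lia.
have f3 : fold_bin m 3 = fold_bin m 0.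
  rewrite /fold_bin bin0 binn addn0 addnC -[in RHS](bin_sub (leq_addr _ _)).
  by rewrite addKn.
have f2 : fold_bin m 2 = fold_bin m 1.
  rewrite /fold_bin addnC; congr addn; rewrite -[LHS]bin_sub; try congr binomial; lia.
have lo : (\prod_(0 <= r < 4) fold_bin m r = (fold_bin m 0 * fold_bin m 1) ^ 2)%N.
  rewrite !big_nat_recr // big_geq // f2 f3.
  by move: (fold_bin m 0) (fold_bin m 1) => a b /=; ring.
have hi : (\prod_(4 <= r < m) fold_bin m r = (\prod_(4 <= r < h.+2) 'C(m + 3, r)) ^ 2)%N.
  rewrite (@big_cat_nat _ _ _ h.+2); [|lia|rewrite /m; lia].
  rewrite prod_upper_half_reflect // expnS expn1.
  congr muln; apply: eq_big_nat => r /andP[r1 r2].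
    by rewrite fE.
  rewrite fE /m; last lia.
  by rewrite -bin_sub; [congr binomial|]; lia.
rewrite -(big_mkord xpredT) (@big_cat_nat _ _ _ 4) //; last by rewrite /m; lia.
by rewrite lo hi /half_prod doubleK [RHS]expnMn.
Qed.

(** With N = 2h + 3, C(N, r) r! (N - r)! = N! for each of the h - 2 indices r, while r and N - r
    together run once through 4, ..., 2h - 1. *)
Lemma prod_bin_fact (h : nat) : (1 < h)%N ->
  (\prod_(4 <= r < h.+2) 'C(h.*2 + 3, r) * \prod_(4 <= b < h.*2) b`! =
   (h.*2 + 3)`! ^ (h - 2))%N.
Proof.
move=> h_gt1.
have -> : (\prod_(4 <= b < h.*2) b`! =
    \prod_(4 <= r < h.+2) (r`! * (h.*2 + 3 - r)`!))%N.
  rewrite (@big_cat_nat _ _ _ h.+2); [|lia|lia].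
  by rewrite prod_upper_half_reflect // [RHS]big_split.
rewrite -big_split /=.
rewrite (eq_big_nat _ _ (F2 := fun=> (h.*2 + 3)`!)).
  by rewrite prod_nat_const_nat; congr (_ ^ _)%N; lia.
move=> r /andP[r1 r2]; rewrite bin_fact //; lia.
Qed.

(** Pairing gives (2j)! (2j + 1)! = (2j)!^2 (2j + 1); the odd factors 5, 7, ..., 2h - 1 make up (2h
    - 1)!! except for its factor 3. *)
Lemma prod_fact_double_fact (h : nat) : (1 < h)%N ->
  (3 * \prod_(4 <= b < h.*2) b`! =
   (\prod_(2 <= j < h) (j.*2)`!) ^ 2 * double_fact (h.*2 - 1))%N.
Proof.
elim: h => // h IHh; rewrite ltnS leq_eqVlt => /orP[/eqP<-|h_gt1].
  by rewrite !big_geq.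
have [n en] : exists n, h.*2 = n.+1 by exists h.*2.-1; lia.
have := IHh h_gt1; rewrite doubleS (@big_nat_recr _ _ _ h.*2.+1)
  ?(@big_nat_recr _ _ _ h.*2) ?(@big_nat_recr _ _ _ h); try lia.
rewrite en.
rewrite !subSS !subn0 [double_fact n.+2]/=.
move: (\prod_(4 <= b < n.+1) _)%N (\prod_(2 <= j < h) _)%N => W A /= eW.
rewrite mulnA mulnA eW (factS n.+1); ring.
Qed.

Lemma fact_double_fact n : (n.+1`! = double_fact n.+1 * double_fact n)%N.
Proof.
by elim: n => // n IHn; rewrite factS IHn /=; ring.
Qed.

Lemma fold_bin0 m : (fold_bin m 0 * 6 = 6 + (m + 3) * (m + 2) * (m + 1))%N.
Proof.
have e : 'C(m + 3, m) = 'C(m + 3, 3) by rewrite -(bin_sub (leq_addl _ _)) addnK.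
rewrite /fold_bin bin0 addn0 e mulnDl addn3 addn2 addn1.
have -> : ('C(m.+3, 3) * 6 = m.+3 ^_ 3)%N by exact: bin_ffact.
by rewrite !ffactSS ffactn0; ring.
Qed.

Lemma fold_bin1 m : (fold_bin m 1 * 2 = (m + 3) * (m + 4))%N.
Proof.
have e : 'C(m + 3, m + 1) = 'C(m + 3, 2).
  by rewrite -[RHS]bin_sub; [congr binomial|]; lia.
rewrite /fold_bin bin1 e mulnDl addn3.
have -> : ('C(m.+3, 2) * 2 = m.+3 ^_ 2)%N by exact: bin_ffact.
by rewrite !ffactSS ffactn0; ring.
Qed.

(** * Computations in F_p *)

Lemma fact_Fp_neq0 (p n : nat) : prime p -> (n < p)%N -> n`!%:R != 0 :> 'F_p.
Proof.
move=> p_pr; elim: n => [|n IHn] np; first by rewrite oner_eq0.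
rewrite factS natrM mulf_neq0 ?IHn ?(ltnW np) //.
by rewrite -(dvdn_pcharf (pchar_Fp p_pr)) gtnNdvd.
Qed.

Lemma legendreE (p : nat) (a : int) :
  prime p -> legendre a p = qchar (a%:~R : 'F_p).
Proof.
move=> p_pr; have pC := pchar_Fp p_pr.
rewrite /legendre /qchar (dvdz_pcharf pC); case: eqP => // _.
congr (if _ then _ else _); apply/existsP/existsP => -[x].
  rewrite eqz_mod_dvd (dvdz_pcharf pC) rmorphB rmorphXn /= subr_eq0 => ex.
  by exists (x : nat)%:R.
move=> ex; have xp : (x < p)%N by rewrite -[X in (_ < X)%N](Fp_cast p_pr).
exists (Ordinal xp); rewrite eqz_mod_dvd (dvdz_pcharf pC) rmorphB rmorphXn /=.
by rewrite subr_eq0 (eqP ex) -[in X in X == _](natr_Zp x).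
Qed.

Section ResiduesFp.
Variables (p k m : nat).
Hypotheses (p_pr : prime p) (k_ge2 : (1 < k)%N) (ep : p = (k * m).+1).
Hypothesis evm : ~~ odd m.
Local Notation F := 'F_p.

Lemma km_Fp : k%:R * m%:R = -1 :> F.
Proof.
apply/eqP; rewrite -addr_eq0 -natrM natr1 -ep; apply/eqP.
exact: pchar_Fp_0.
Qed.

Lemma k_Fp_neq0 : k%:R != 0 :> F.
Proof.
apply: contraTneq isT => k0; move: km_Fp; rewrite k0 mul0r => /eqP.
by rewrite eq_sym oppr_eq0 oner_eq0.
Qed.

Lemma kth_power_residue_unity (a : int) :
  kth_power_residue p k a -> (a%:~R : F) ^+ m = 1.
Proof.
have pC := pchar_Fp p_pr.
case=> pa [x /eqP]; rewrite eqz_mod_dvd (dvdz_pcharf pC) rmorphB subr_eq0 rmorphXn /=.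
rewrite (dvdz_pcharf pC) in pa; move/eqP=> ea.
have nzx : x%:~R != 0 :> F.
  by apply: contra_neq pa => x0; rewrite ea x0 expr0n; case: k k_ge2.
apply: (mulIf nzx); rewrite ea mul1r -exprM -exprSr -ep.
by rewrite -[X in _ ^+ X](card_Fp p_pr) expf_card.
Qed.

End ResiduesFp.

(** Gives q up to squares. By the parity of h, the power (m + 3)!^(h-2) is a square or a square
    times (m + 3)!; the last identity evaluates this leftover factorial. *)
Lemma half_prod_Fp (p k h : nat) : prime p -> (1 < k)%N -> (1 < h)%N ->
  p = (k * h.*2).+1 ->
  let K := k%:R : 'F_p in
  let E := 6 * K ^+ 3 + (3 * K - 1) * (2 * K - 1) * (K - 1) in
  let D := (double_fact (h.*2 - 1))%:R : 'F_p in
  exists2 A, A != 0 &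
  [/\ (half_prod h.*2)%:R * (K * D) * (2 * K ^+ 2 * A) ^+ 2 =
        E * (3 * K - 1) * (4 * K - 1) * (h.*2 + 3)`!%:R ^+ (h - 2),
      D != 0 &
      K ^+ 3 * (h.*2 + 3)`!%:R =
        (K - 1) * (2 * K - 1) * (3 * K - 1) * D * (double_fact h.*2)%:R].
Proof.
move=> p_pr k_gt1 h_gt1 ep K E D; pose A := (\prod_(2 <= j < h) (j.*2)`!)%:R : 'F_p.
 have pC := pchar_Fp p_pr.
have nzf n : (n < p)%N -> n`!%:R != 0 :> 'F_p by exact: fact_Fp_neq0.
have km := km_Fp p_pr ep; rewrite -/K in km.
set M := _%:R in km.
have p_big : (h.*2 + 3 < p)%N by nia.
have nz2 : 2 != 0 :> 'F_p by have := nzf 2; apply; lia.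
have nz6 : 6 != 0 :> 'F_p by have := nzf 3; apply; lia.
have nz3 : 3 != 0 :> 'F_p.
  by apply: contra_neq nz6 => e3; rewrite -[6]/(3 * 2)%:R natrM e3 mul0r.
have nzK := k_Fp_neq0 p_pr ep; rewrite -/K in nzK.
have eh : h.*2 = (h.*2 - 1).+1 by lia.
have fm : h.*2`!%:R = (double_fact h.*2)%:R * D.
  by rewrite {1 2}eh fact_double_fact natrM.
have nzA : A != 0.
  rewrite /A natr_prod prodf_seq_neq0; apply/allP => j.
  rewrite mem_index_iota => /andP[j1 j2] /=.
  by apply: nzf; lia.
have nzD : D != 0.
  have : h.*2`!%:R != 0 :> 'F_p by apply: nzf; lia.
  by rewrite fm mulf_eq0 negb_or => /andP[].
exists A => //; split=> //; last first.
  rewrite !(addnS, addn0) !factS !natrM fm -!(natr1 h.*2.+1) -!(natr1 h.*2) -/M.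
  (* Since K M = -1, K (M + j) = j K - 1: this is the source of all the factors j K - 1. *)
  have -> : K - 1 = K * (M + 1) by rewrite mulrDr km; ring.
  have -> : 2 * K - 1 = K * (M + 1 + 1) by rewrite !mulrDr km; ring.
  have -> : 3 * K - 1 = K * (M + 1 + 1 + 1) by rewrite !mulrDr km; ring.
  by rewrite -(natr1 h.*2.+2) -!(natr1 h.*2.+1) -!(natr1 h.*2) -/M; ring.
have e0 : (fold_bin h.*2 0)%:R * 6 * K ^+ 3 = E.
  rewrite -[6]/(6%:R) -natrM fold_bin0 natrD !natrM !natrD -/M /E.
  have -> : K - 1 = K * (M + 1) by rewrite mulrDr km; ring.
  have -> : 2 * K - 1 = K * (M + 2) by rewrite !mulrDr km; ring.
  have -> : 3 * K - 1 = K * (M + 3) by rewrite !mulrDr km; ring.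
  by ring.
have e1 : (fold_bin h.*2 1)%:R * 2 * K ^+ 2 = (3 * K - 1) * (4 * K - 1).
  rewrite -[2 in LHS]/(2%:R) -natrM fold_bin1 !natrM !natrD -/M.
  have -> : 4 * K - 1 = K * (M + 4) by rewrite !mulrDr km; ring.
  have -> : 3 * K - 1 = K * (M + 3) by rewrite !mulrDr km; ring.
  by ring.
pose P := (\prod_(4 <= r < h.+2) 'C(h.*2 + 3, r))%:R : 'F_p.
pose W := (\prod_(4 <= b < h.*2) b`!)%:R : 'F_p.
have eP : P * W = (h.*2 + 3)`!%:R ^+ (h - 2) by rewrite -natrM prod_bin_fact // natrX.
have eW : 3 * W = A ^+ 2 * D.
  by rewrite -[3]/(3%:R) -natrM prod_fact_double_fact // natrM natrX.
rewrite -eP -(mulrA E) -e1 -e0 /half_prod doubleK !natrM -/P.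
transitivity ((fold_bin h.*2 0)%:R * (fold_bin h.*2 1)%:R * P * 4 * K ^+ 5 * (A ^+ 2 * D)).
  by ring.
by rewrite -eW; ring.
Qed.


(** * Legendre symbols of the square root *)

Lemma isqrtz_Sdet (m n : nat) (alpha : 'I_m -> int) :
  ~~ odd m -> odd n -> isqrtz (Sdet alpha n (-1)) ^+ 2 = Sdet alpha n (-1).
Proof.
move=> evm odn; apply: isqrtz_det_skew => //; apply/matrixP => i j.
by rewrite !mxE !mulN1r -(opprB (alpha i)) exprNn -signr_odd odn mulN1r.
Qed.

Lemma legendre_isqrtz (p : nat) (S T : int) (q w : 'F_p) :
  prime p -> (p = 1 %[mod 4])%N -> w != 0 -> isqrtz S ^+ 2 = S ->
  S%:~R = (T%:~R * q * w ^+ 2) ^+ 2 :> 'F_p ->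
  legendre (isqrtz S) p = legendre T p * qchar q.
Proof.
move=> p_pr p4 nzw eS /eqP; rewrite -[S in S%:~R]eS rmorphXn /= eqf_sqr !legendreE //.
rewrite -qcharM -(qchar_mul_sqr (_ * q) nzw).
by case/orP => /eqP-> //; rewrite qcharN // card_Fp.
Qed.

Lemma legendre_isqrtz_Sdet (p k m : nat) (alpha : 'I_m -> int) :
  prime p -> (1 < k)%N -> p = (k * m).+1 -> (p = 1 %[mod 4])%N ->
  ~~ odd m -> (3 < m)%N -> (forall i, kth_power_residue p k (alpha i)) ->
  legendre (isqrtz (Sdet alpha (3 + m) (-1))) p =
    legendre (Tprod alpha) p * qchar ((half_prod m)%:R : 'F_p).
Proof.
move=> p_pr k_gt1 ep p4 evm m_gt3 res; have pC := pchar_Fp p_pr.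
pose a i : 'F_p := (alpha i)%:~R.
have am i : a i ^+ m = 1 by apply: (kth_power_residue_unity p_pr k_gt1 ep).
have nzw : \prod_i a i != 0.
  by apply/prodf_neq0 => i _; have [] := res i; rewrite (dvdz_pcharf pC).
apply: (legendre_isqrtz p_pr p4 nzw); first by rewrite isqrtz_Sdet // oddD (negPf evm).
rewrite -det_map_mx; set M := map_mx _ _.
have -> : M = \matrix_(i, j) (a i - a j) ^+ (m + 3).
  by apply/matrixP => i j; rewrite !mxE mulN1r rmorphXn rmorphB addnC.
have -> : (Tprod alpha)%:~R = \prod_(i < m) \prod_(j < m | (i < j)%N) (a i - a j).
  rewrite rmorph_prod; apply: eq_bigr => i _; rewrite rmorph_prod.
  by apply: eq_bigr => j _; rewrite rmorphB.
rewrite det_power_diff //.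
have [h em] : exists h, m = h.*2 by exists m./2; rewrite even_halfK.
have -> : (\prod_(r < m) fold_bin m r = half_prod m ^ 2)%N.
  by rewrite em prod_fold_bin //; lia.
by rewrite natrX; ring.
Qed.

(** Handles m = 2, which the folding argument (m > 3) does not reach: a skew-symmetric 2 by 2
    determinant is the square of its off-diagonal entry. *)
Lemma Sdet2 (alpha : 'I_2 -> int) (n : nat) :
  odd n -> Sdet alpha n (-1) = (Tprod alpha ^+ n) ^+ 2.
Proof.
move=> odn; have -> : Tprod alpha = alpha 0 - alpha 1.
  rewrite /Tprod !big_ord_recl big_ord0 mulr1 !big_mkcond !big_ord_recl !big_ord0 /=.
  rewrite [X in _ * X]big_pred0; last by case=> [[|[]]].
  by rewrite !mulr1 mul1r; congr (alpha _ - alpha _); apply: val_inj.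
rewrite /Sdet (expand_det_row _ 0) !big_ord_recl big_ord0 /cofactor !det_mx11 !mxE /=.
have -> : lift 0 0 = 1 :> 'I_2 by apply: val_inj.
have -> : lift 1 0 = 0 :> 'I_2 by apply: val_inj.
rewrite !mulN1r subrr expr0n.
have -> : (alpha 1 - alpha 0) ^+ n = - (alpha 0 - alpha 1) ^+ n.
  by rewrite -opprB exprNn -signr_odd odn mulN1r.
by case: n odn => // n _; rewrite [(n.+1 == 0)%N]/= mulr0n; ring.
Qed.

Section LegendreSdet.
Variables (p k m : nat) (alpha : 'I_m -> int).
Hypotheses (p_pr : prime p) (k_gt1 : (1 < k)%N) (ep : p = (k * m).+1).
Hypothesis res : forall i, kth_power_residue p k (alpha i).
Let K := k%:Z.
Let S := Sdet alpha (3 + m) (-1).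
Let T := Tprod alpha.

Lemma legendre_isqrtz_Sdet_dvd4 : (0 < m)%N -> (4 %| m)%N ->
  legendre (isqrtz S) p =
    legendre (K * (3 * K - 1) * (4 * K - 1) *
      (6 * K ^+ 3 + (3 * K - 1) * (2 * K - 1) * (K - 1))) p *
    legendre (double_fact (m - 1)%N)%:Z p *
    legendre T p.
Proof.
move=> m_gt0 /dvdnP[c em]; have eh : m = c.*2.*2 by lia.
have ec : (c.*2 - 2 = (c - 1) * 2)%N by lia.
have nzK := k_Fp_neq0 p_pr ep.
rewrite (legendre_isqrtz_Sdet p_pr k_gt1 ep) //; [|rewrite ep eh; lia|lia|lia].
rewrite mulrC; congr (_ * _); rewrite !legendreE // -qcharM.
have ep' : p = (k * (c.*2).*2).+1 by rewrite -eh.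
have [|] := half_prod_Fp p_pr k_gt1 _ ep'; first by lia.
rewrite -!eh => A nzA; set D := (double_fact _)%:R => -[eq nzD _].
have nz2 : 2 != 0 :> 'F_p by have := @fact_Fp_neq0 p 2 p_pr; apply; rewrite ep; nia.
have nzN : (m + 3)`!%:R != 0 :> 'F_p by apply: fact_Fp_neq0 => //; rewrite ep; nia.
move: ((half_prod m)%:R : 'F_p) eq => q eq.
rewrite !(rmorph_nat, rmorph1, rmorphM, rmorphB, rmorphD, rmorphXn) /=.
rewrite -[K%:~R]/(k%:R) -[(double_fact _)%:~R]/D.
(* With m = 4c, h - 2 = 2(c - 1) and the factorial power is a square; multiplying the identity by
   [k%:R * D] squares that factor on the left and moves it to the right. *)
apply: (@qchar_eq_mod_sqr _ _ _ (k%:R * D * (2 * k%:R ^+ 2 * A))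
  ((m + 3)`!%:R ^+ (c - 1))).
- by rewrite !mulf_neq0 ?expf_neq0.
- by rewrite expf_neq0.
transitivity (q * (k%:R * D) * (2 * k%:R ^+ 2 * A) ^+ 2 * (k%:R * D)); first by ring.
by rewrite eq ec exprM; ring.
Qed.

Lemma legendre_isqrtz_Sdet_mod4_2 : (2 < m)%N -> ~~ odd k -> m = 2 %[mod 4] ->
  legendre (isqrtz S) p =
    legendre ((K - 1) * (2 * K - 1) * (4 * K - 1) *
      (6 * K ^+ 3 + (3 * K - 1) * (2 * K - 1) * (K - 1))) p *
    legendre (double_fact m)%:Z p *
    legendre T p.
Proof.
move=> m_gt2 evk m2; pose c := (m %/ 4)%N; have eh : m = c.*2.+1.*2 by lia.
have ec : (c.*2.+1 - 2 = ((c - 1) * 2).+1)%N by lia.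
have nzK := k_Fp_neq0 p_pr ep.
have p4 : (p = 1 %[mod 4])%N by rewrite ep eh -(even_halfK evk); nia.
rewrite (legendre_isqrtz_Sdet p_pr k_gt1 ep) //; [|lia|lia].
rewrite mulrC; congr (_ * _); rewrite !legendreE // -qcharM.
have ep' : p = (k * (c.*2.+1).*2).+1 by rewrite -eh.
have [|] := half_prod_Fp p_pr k_gt1 _ ep'; first by lia.
rewrite -!eh => A nzA; set D := (double_fact (m - 1))%:R => -[eq nzD eN].
have nz2 : 2 != 0 :> 'F_p by have := @fact_Fp_neq0 p 2 p_pr; apply; rewrite ep; nia.
have nzN : (m + 3)`!%:R != 0 :> 'F_p by apply: fact_Fp_neq0 => //; rewrite ep; nia.
have nz3k : 3 * k%:R - 1 != 0 :> 'F_p.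
  have : k%:R ^+ 3 * (m + 3)`!%:R != 0 :> 'F_p by rewrite mulf_neq0 ?expf_neq0.
  by rewrite eN !mulf_eq0 !negb_or => /andP[/andP[/andP[]]].
move: ((half_prod m)%:R : 'F_p) eq => q eq.
rewrite !(rmorph_nat, rmorph1, rmorphM, rmorphB, rmorphD, rmorphXn) /=.
rewrite -[K%:~R]/(k%:R) -[(double_fact _)%:~R]/((double_fact m)%:R).
(* Now h - 2 is odd. Multiplying by k^3 and evaluating k^3 (m + 3)! by [eN] cancels [D], squares 3k
   - 1, and completes k to k^4 on the left. *)
apply: (@qchar_eq_mod_sqr _ _ _ (2 * k%:R ^+ 4 * A)
  ((3 * k%:R - 1) * (m + 3)`!%:R ^+ (c - 1))).
- by rewrite !mulf_neq0 ?expf_neq0.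
- by rewrite !mulf_neq0 ?expf_neq0.
pose x : 'F_p := k%:R; rewrite -/x in eq eN *; apply: (mulIf nzD).
transitivity (q * (x * D) * (2 * x ^+ 2 * A) ^+ 2 * x ^+ 3); first by ring.
rewrite eq ec (exprS _ ((c - 1) * 2)) exprM.
transitivity (((6 * x ^+ 3 + (3 * x - 1) * (2 * x - 1) * (x - 1)) *
  (3 * x - 1) * (4 * x - 1)) * (x ^+ 3 * (m + 3)`!%:R) *
  ((m + 3)`!%:R ^+ (c - 1)) ^+ 2); first by ring.
by rewrite eN; ring.
Qed.

End LegendreSdet.

(** The root is |T^5|, its sign is harmless since p = 1 mod 4, and T^5 = T (T^2)^2. *)
Lemma legendre_isqrtz_Sdet2 (p m : nat) (alpha : 'I_m -> int) :
  prime p -> (p = 1 %[mod 4])%N -> m = 2 ->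
  legendre (isqrtz (Sdet alpha (3 + m) (-1))) p = legendre (Tprod alpha) p.
Proof.
move=> p_pr p4 em; move: alpha; rewrite em => alpha.
rewrite Sdet2 // isqrtz_sqr !legendreE //; set T := Tprod alpha.
have -> : qchar (`|T ^+ 5|%:~R : 'F_p) = qchar ((T%:~R : 'F_p) ^+ 5).
  by case: (ger0P (T ^+ 5)) => _; rewrite ?rmorphN ?qcharN ?card_Fp //= rmorphXn.
have [->|nzT] := eqVneq (T%:~R : 'F_p) 0; first by rewrite expr0n.
by rewrite -[RHS](qchar_mul_sqr _ (expf_neq0 2 nzT)) -exprM -exprS.
Qed.

Theorem theorem1p11 (p k : nat) (p_prime : prime p) (p_odd : odd p)
    (k_ge2 : (2 <= k)%N) (k_le : (k <= (p - 1) %/ 2)%N)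
    (p_mod : p = 1 %[mod 2 * k])
    (alpha : 'I_((p - 1) %/ k)%N -> int)
    (alpha_res : kth_residue_system p k alpha) :
  let m := ((p - 1) %/ k)%N in
  let K := k%:Z in
  let S := Sdet alpha (3 + m)%N (-1) in
  let T := Tprod alpha in
  [/\ isqrtz S ^+ 2 = S,
      p = 1 %[mod 4 * k] ->
        legendre (isqrtz S) p =
          legendre (K * (3 * K - 1) * (4 * K - 1) *
            (6 * K ^+ 3 + (3 * K - 1) * (2 * K - 1) * (K - 1))) p *
          legendre (double_fact (m - 1)%N)%:Z p *
          legendre T p
    & ~~ odd k -> p = (2 * k + 1)%N %[mod 4 * k] ->
        legendre (isqrtz S) p =
          if p == (2 * k + 1)%N then legendre T p
          else
            legendre ((K - 1) * (2 * K - 1) * (4 * K - 1) *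
              (6 * K ^+ 3 + (3 * K - 1) * (2 * K - 1) * (K - 1))) p *
            legendre (double_fact m)%:Z p *
            legendre T p].
Proof.
move=> m K S T; have [res _ _] := alpha_res.
have p_gt1 := prime_gt1 p_prime.
have dvd_sub d : p = 1 %[mod d] -> (d %| p - 1)%N.
  by move/eqP; rewrite eqn_mod_dvd // ltnW.
have [c ec] := dvdnP (dvd_sub _ p_mod).
have em : m = c.*2.
  by rewrite /m ec (_ : c * (2 * k) = c.*2 * k)%N ?mulnK //; lia.
have ep : p = (k * m).+1 by rewrite em; nia.
have evm : ~~ odd m by rewrite em odd_double.
have m_gt0 : (0 < m)%N by rewrite lt0n; apply: contraTneq p_gt1 => m0; rewrite ep m0; lia.
have k_gt0 : (0 < k)%N by lia.
(* This conjunct certifies that [isqrtz S] is a genuine square root and not a junk value. *)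
split; first by apply: isqrtz_Sdet; rewrite // oddD (negPf evm).
  move=> p4k; have [d ed] := dvdnP (dvd_sub _ p4k).
  apply: (legendre_isqrtz_Sdet_dvd4 p_prime k_ge2 ep res m_gt0).
  apply/dvdnP; exists d; apply/eqP; rewrite -(eqn_pmul2l k_gt0).
  by rewrite -[(k * m)%N]/((k * m).+1.-1) -ep -subn1 ed mulnA mulnC.
move=> evk p4k.
have m2 : m = 2 %[mod 4].
  apply/eqP; rewrite -(eqn_pmul2l k_gt0) !muln_modr.
  move/eqP: p4k; rewrite ep -addn1 eqn_modDr => /eqP.
  by rewrite (mulnC 4) (mulnC 2) => ->.
(* Both k and m are even, so 4 divides k m = p - 1. *)
have p4 : (p = 1 %[mod 4])%N.
  by rewrite ep em -(even_halfK evk) -!muln2 mulnACA -addn1 modnMDl.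
have m2E : (p = 2 * k + 1)%N <-> m = 2.
  rewrite ep -addn1; split=> [/eqP|->]; last by rewrite mulnC.
  by rewrite eqn_add2r mulnC eqn_pmul2r // => /eqP.
case: eqP => [/m2E|p2]; first exact: legendre_isqrtz_Sdet2.
apply: (legendre_isqrtz_Sdet_mod4_2 p_prime k_ge2 ep res _ evk m2).
have: m <> 2 by move=> /m2E.
by move: m_gt0 m2; case: (m) => [|[|[|]]].
Qed.
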